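(* Let $n=2m$ be even and divisible by $3$. If the defining sequence $a_1\dots a_m\in\{0,1,2\}^m$ of a $\sigma_n$-partition satisfies that for every $j\in\{1,\dots,m-1\}$ either $a_{j+1}=a_j$ or $a_{j+1}\equiv a_j+1\pmod 3$, then there exists a transitive $\sigma_n$-orientation for this $\sigma_n$-partition.
   Context: $K_n$ is the complete graph on the vertex set $[n]=\{0,1,\dots,n-1\}$; vertices are considered as residue classes modulo $n$, and $\sigma_n$ is the cyclic permutation of $[n]$ with $\sigma_n(i)=i+1$ (mod $n$), acting also on edges, graphs and digraphs. A $\sigma_n$-partition is a partition of the edge set of $K_n$ into three graphs $F_0,F_1,F_2$ on vertex set $[n]$ with $\sigma_n(F_0)=F_1$ and $\sigma_n(F_1)=F_2$. It exists only if $n$ is divisible by $3$, and then also $\sigma_n(F_2)=F_0$. The label $\ell(a,b)\in\{0,1,2\}$ of an edge $\{a,b\}$ is the index $d$ with $\{a,b\}\in F_d$. The defining sequence of the $\sigma_n$-partition is $a_1,\dots,a_{\lfloor n/2\rfloor}$ with $a_j=\ell(0,j)$. A transitive orientation $T$ of $K_n$ (i.e. a transitive tournament on $[n]$) is a transitive $\sigma_n$-orientation of the $\sigma_n$-partition if the subgraphs $\vec F_0,\vec F_1,\vec F_2$ of $T$ that are the orientations of $F_0,F_1,F_2$ satisfy $\sigma_n(\vec F_0)=\vec F_1$ and $\sigma_n(\vec F_1)=\vec F_2$ as digraphs. *)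

(* Defs.v *)
From mathcomp Require Import all_boot all_order all_algebra.

Set Implicit Arguments.
Unset Strict Implicit.
Unset Printing Implicit Defensive.

(* A graph on [n] is its set of edges, each edge being a two-element set of
   vertices; a digraph on [n] is its set of arcs (tail, head). *)
Definition graph (n : nat) : Type := {set {set 'I_n}}.
Definition digraph (n : nat) : Type := {set 'I_n * 'I_n}.

Definition complete_graph (n : nat) : graph n := [set e : {set 'I_n} | #|e| == 2].

(* [ordS] is the cyclic permutation i |-> i + 1 (mod n) of 'I_n. *)
Definition sigma_graph n (G : graph n) : graph n :=
  [set (@ordS n) @: (e : {set 'I_n}) | e in G].

Definition sigma_digraph n (D : digraph n) : digraph n :=
  [set (ordS a.1, ordS a.2) | a in D].

Definition sigma_partition n (F : 'I_3 -> graph n) : Prop :=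
  [/\ forall d d' : 'I_3, d != d' -> [disjoint F d & F d'],
      \bigcup_(d : 'I_3) F d = complete_graph n,
      sigma_graph (F 0%R) = F 1%R
    & sigma_graph (F 1%R) = F 2%R].

(* The pair of vertices represented by the integers a and b, read as residue
   classes modulo n. *)
Definition edge (n a b : nat) : {set 'I_n} :=
  [set x : 'I_n | (x == a %[mod n]) || (x == b %[mod n])].

(* If the F d partition the edges of the complete graph and a, b are distinct
   modulo n, the index picked is unique; the default value is never used. *)
Definition label n (F : 'I_3 -> graph n) (a b : nat) : 'I_3 :=
  odflt 0%R [pick d : 'I_3 | edge n a b \in F d].

(* Meaningful for 1 <= j <= n %/ 2. *)
Definition defining_sequence n (F : 'I_3 -> graph n) (j : nat) : 'I_3 :=
  label F 0 j.

Definition transitive_tournament n (T : digraph n) : Prop :=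
  [/\ forall x, (x, x) \notin T,
      forall x y, x != y -> ((x, y) \in T) (+) ((y, x) \in T)
    & forall x y z, (x, y) \in T -> (y, z) \in T -> (x, z) \in T].

Definition orientation_in n (T : digraph n) (G : graph n) : digraph n :=
  [set a in T | [set a.1; a.2] \in G].

(* No condition relates the orientation of F 2 to that of F 0: the image of
   the former under sigma need not be the latter. *)
Definition transitive_sigma_orientation n (F : 'I_3 -> graph n)
    (T : digraph n) : Prop :=
  [/\ transitive_tournament T,
      sigma_digraph (orientation_in T (F 0%R)) = orientation_in T (F 1%R)
    & sigma_digraph (orientation_in T (F 1%R)) = orientation_in T (F 2%R)].

(* Main.v *)
Require Import Defs.
From mathcomp Require Import all_boot all_order all_algebra.
From mathcomp Require Import zify.

(** The label sequence a_j = l(0, j) makes sense for 0 < j < n, and shifting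
    the edge {0, n - j} by j gives a_(n-j) = a_j - j mod 3. Hence the
    hypothesis that a_(j+1) - a_j is 0 or 1 for j < m propagates to all
    j < n - 1, and a lifts to a sequence b of natural numbers with steps 0
    or 1, with b_j = a_j mod 3 and the exact symmetry
    b_(n-j) + j = b_j + m ([lift_mod3], [extend_step], [extend_sym]).

    For x < y put L(x, y) = x + b_(y-x), the level of the edge. Its residue
    modulo 3 is the label of {x, y} ([lab_level]). Rotating an edge adds 1 to
    its level, except that when y wraps around the two ends are exchanged and
    the level also drops by m. Orient x -> y when L(x, y) %/ m is even and
    y -> x otherwise. As 3 divides m, the levels L and L + 1 have the same
    quotient by m unless L = 2 mod 3, so that this orientation is compatible
    with the rotation on the edges of labels 0 and 1 ([arc_ordS]).

    It is transitive because, for u < v < w, the bounds on the steps of b and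
    its symmetry give
      L(u, v) <= L(u, w) <= L(v, w) <= L(u, v) + m,
    so if L(u, v) and L(v, w) have quotients by m of the same parity, these
    quotients are equal and L(u, w) has that quotient as well
    ([forward_trans]). *)

(** * Lifting the label sequence to the natural numbers *)

(** A sequence of natural numbers that starts like [a] and steps up by 1
    whenever [a] changes. *)
Definition lift (a : nat -> nat) (j : nat) : nat :=
  a 1 + \sum_(1 <= i < j) (a i.+1 != a i).

Lemma lift_step a j : lift a j <= lift a j.+1 <= (lift a j).+1.
Proof.
case: j => [|j]; rewrite /lift; first by rewrite !big_geq ?leqnSn ?leqnn.
rewrite (big_nat_recr j.+1) //= addnA leq_addr.
by case: (_ != _); rewrite /= ?addn1 ?addn0 ?leqnSn ?leqnn.
Qed.

Lemma lift_mod3 a m :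
  (forall j, a j < 3) ->
  (forall j, 1 <= j <= m.-1 ->
     a j.+1 = a j \/ a j.+1 = (a j).+1 %[mod 3]) ->
  forall j, 1 <= j <= m -> lift a j %% 3 = a j.
Proof.
move=> a3 aS; elim=> [//|j IHj] jm.
have [->|j0] := posnP j; first by rewrite /lift big_geq // addn0 modn_small.
have aj3 := a3 j; have aj13 := a3 j.+1.
have IH : lift a j %% 3 = a j by apply: IHj; lia.
have -> : lift a j.+1 = lift a j + (a j.+1 != a j).
  by rewrite /lift big_nat_recr //= addnA.
have /aS : 1 <= j <= m.-1 by lia.
by case: eqP => /= [-> _|ne [//|]]; lia.
Qed.

(** The extension of [b], given on [0, m], to [0, 2m] by the symmetry
    b_(2m-j) + j = b_j + m. *)
Definition extend (m : nat) (b : nat -> nat) (j : nat) : nat :=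
  if j <= m then b j else b (2 * m - j) + (j - m).

Lemma extend_step m b :
  (forall j, b j <= b j.+1 <= (b j).+1) ->
  forall j, j < 2 * m -> extend m b j <= extend m b j.+1 <= (extend m b j).+1.
Proof.
move=> bS j j2m; rewrite /extend.
case: (ltngtP j m) => jm; first by rewrite bS.
  have := bS (2 * m - j.+1); have -> : (2 * m - j.+1).+1 = 2 * m - j by lia.
  lia.
have := bS (2 * m - j.+1); have -> : (2 * m - j.+1).+1 = j by lia.
lia.
Qed.

Lemma extend_sym m b j :
  j <= 2 * m -> extend m b (2 * m - j) + j = extend m b j + m.
Proof.
move=> j2m; rewrite /extend; case: (ltngtP j m) => jm.
- have -> : (2 * m - j <= m) = false by lia.
  have -> : 2 * m - (2 * m - j) = j by lia.
  lia.
- have -> : (2 * m - j <= m) by lia.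
  lia.
- have -> : 2 * m - j = m by lia.
  by rewrite leqnn jm.
Qed.

Lemma step_range n b :
  (forall j, j < n -> b j <= b j.+1 <= (b j).+1) ->
  forall k d, k + d <= n -> b k <= b (k + d) <= b k + d.
Proof.
move=> bS k; elim=> [|d IHd] kdn; first by rewrite !addn0 leqnn.
have := IHd ltac:(lia); have := bS (k + d) ltac:(lia).
rewrite addnS; lia.
Qed.

(** * The orientation *)

(** The level of the edge {x, y}; only meaningful for [x < y], because of the
    truncated subtraction. *)
Definition level (b : nat -> nat) (x y : nat) : nat := x + b (y - x).

(** Whether the edge {x, y} with [x < y] points from [x] to [y]. *)
Definition forward (m : nat) (b : nat -> nat) (x y : nat) : bool :=
  ~~ odd (level b x y %/ m).

(** Whether there is an arc from [x] to [y], with no order assumed on [x] and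
    [y]. *)
Definition arc (m : nat) (b : nat -> nat) (x y : nat) : bool :=
  if x < y then forward m b x y else (y < x) && ~~ forward m b y x.

Lemma arcC m b x y : x != y -> arc m b y x = ~~ arc m b x y.
Proof. by rewrite /arc; case: ltngtP => //=; rewrite negbK. Qed.

Lemma forward_trans m b u v w :
  (forall j, j < 2 * m -> b j <= b j.+1 <= (b j).+1) ->
  (forall j, j <= 2 * m -> b (2 * m - j) + j = b j + m) ->
  u < v -> v < w -> w < 2 * m ->
  forward m b u v = forward m b v w -> forward m b u w = forward m b u v.
Proof.
move=> bS bsym uv vw w2m.
have m0 : 0 < m by lia.
have R := step_range _ _ bS.
have le1 : level b u v <= level b u w.
  have := R (v - u) (w - v) ltac:(lia).
  by rewrite /level (_ : v - u + (w - v) = w - u); lia.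
have le2 : level b u w <= level b v w.
  have := R (w - v) (v - u) ltac:(lia).
  by rewrite /level (_ : w - v + (v - u) = w - u); lia.
have le3 : level b v w <= level b u v + m.
  have := bsym (v - u) ltac:(lia).
  have := R (w - v) (2 * m - (v - u) - (w - v)) ltac:(lia).
  rewrite /level (_ : w - v + _ = 2 * m - (v - u)); lia.
rewrite /forward => /(congr1 negb); rewrite !negbK => eo; congr (~~ _).
have := leq_div2r m le1; have := leq_div2r m le2; have := leq_div2r m le3.
rewrite divnDr ?dvdnn // divnn m0 /= addn1 => q3 q2 q1.
have [e|ne] := eqVneq (level b v w %/ m) (level b u v %/ m).
  by congr odd; lia.
have e : level b v w %/ m = (level b u v %/ m).+1 by lia.
by move: eo; rewrite e /=; case: odd.
Qed.

(** In each of the six orders of [x], [y] and [z], [forward_trans] excludes the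
    cyclic triangle that would violate transitivity. *)
Lemma arc_trans m b x y z :
  (forall j, j < 2 * m -> b j <= b j.+1 <= (b j).+1) ->
  (forall j, j <= 2 * m -> b (2 * m - j) + j = b j + m) ->
  x < 2 * m -> y < 2 * m -> z < 2 * m ->
  arc m b x y -> arc m b y z -> arc m b x z.
Proof.
move=> bS bsym xm ym zm.
have T u v w := @forward_trans m b u v w bS bsym.
rewrite /arc.
case: (ltngtP x y) => // xy; case: (ltngtP y z) => // yz;
  case: (ltngtP x z) => //= xz; try lia.
- by move: (T x y z xy yz zm); do 3![case: (forward m b _ _) => //] => /(_ erefl).
- by move: (T x z y xz yz ym); do 3![case: (forward m b _ _) => //] => /(_ erefl).
- by move: (T z x y xz xy ym); do 3![case: (forward m b _ _) => //] => /(_ erefl).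
- by rewrite xz => ->.
- by move: (T y x z xy xz zm); do 3![case: (forward m b _ _) => //] => /(_ erefl).
- by move: (T y z x yz xz xm); do 3![case: (forward m b _ _) => //] => /(_ erefl).
- by rewrite xz => /negbTE->.
- by move: (T z y x yz xy xm); do 3![case: (forward m b _ _) => //] => /(_ erefl).
Qed.

(** Levels jump to a new block of length [m] only at a multiple of 3; this is
    one use of the divisibility of [m] by 3. *)
Lemma divn_mod3S l m : 3 %| m -> l %% 3 < 2 -> l.+1 %/ m = l %/ m.
Proof.
move=> /dvdnP[p ->] l3; rewrite mulnC !divnMA.
by congr (_ %/ p); lia.
Qed.

(** When [y] is the last vertex, its image 0 comes first, which reverses the
    pair; the drop of the level by [m] compensates for that. *)
Lemma arc_ordS m b (x y : 'I_(2 * m)) :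
  3 %| m ->
  (forall j, j <= 2 * m -> b (2 * m - j) + j = b j + m) ->
  x < y -> level b x y %% 3 < 2 -> arc m b (ordS x) (ordS y) = arc m b x y.
Proof.
move=> m3 bsym xy l3; have := ltn_ord y => y2m.
have m0 : 0 < m by lia.
have := divn_mod3S _ _ m3 l3.
have -> : ordS x = x.+1 :> nat by rewrite /= modn_small //; lia.
have [yS|yS] := ltnP y.+1 (2 * m).
  have -> : ordS y = y.+1 :> nat by rewrite /= modn_small.
  by rewrite /arc ltnS xy /forward /level subSS => <-.
have ey : y.+1 = 2 * m by lia.
have -> : ordS y = 0 :> nat by rewrite /= ey modnn.
rewrite /arc xy /= /forward.
have -> : (level b x y).+1 = level b 0 x.+1 + m.
  have := bsym x.+1 ltac:(lia); rewrite /level subn0 add0n.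
  by rewrite (_ : 2 * m - x.+1 = y - x); lia.
by rewrite divnDr ?dvdnn // divnn m0 addn1 => <-.
Qed.

(** * Labels of edges *)

(** The index of the part containing the edge [e]: [label F a b] unfolds to
    [lab F (edge n a b)]. *)
Definition lab {n} (F : 'I_3 -> graph n) (e : {set 'I_n}) : 'I_3 :=
  odflt 0%R [pick d : 'I_3 | e \in F d].

Lemma lab_mem n (F : 'I_3 -> graph n) (e : {set 'I_n}) d :
  sigma_partition F -> #|e| = 2 -> (e \in F d) = (lab F e == d).
Proof.
case=> disj cov _ _ e2; rewrite /lab.
have : e \in complete_graph n by rewrite inE e2.
rewrite -cov => /bigcupP[c _ ec].
case: pickP => [d' ed'|/(_ c)]; last by rewrite ec.
have [<-//|ne] /= := eqVneq d' d.
by apply/negbTE; have /disjointFr-> := disj _ _ ne.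
Qed.

Lemma ordS_inj n : injective (@ordS n).
Proof. exact: can_inj (@ordSK n). Qed.

Lemma mem_sigma_graph n (G : graph n) (e : {set 'I_n}) :
  ((@ordS n @: e) \in sigma_graph G) = (e \in G).
Proof. exact: (mem_imset _ _ (imset_inj (@ordS_inj n))). Qed.

(** Rotating an edge increases its label; that F 2 is mapped onto F 0 follows
    from the partition property. *)
Lemma lab_ordS n (F : 'I_3 -> graph n) (e : {set 'I_n}) :
  sigma_partition F -> #|e| = 2 -> lab F (@ordS n @: e) = (lab F e).+1 %% 3 :> nat.
Proof.
move=> Fp e2; have [_ _ s01 s12] := Fp.
have se2 : #|@ordS n @: e| = 2 by rewrite card_imset //; exact: ordS_inj.
have := mem_sigma_graph _ (F 0%R) e; rewrite s01 !lab_mem //.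
have := mem_sigma_graph _ (F 1%R) e; rewrite s12 !lab_mem //.
case: (lab F e) (lab F _) => [[|[|[|i]]] //= ?] [[|[|[|i']]] //= ?];
  by rewrite -!val_eqE.
Qed.

Lemma edge_ordS n a b : @ordS n @: edge n a b = edge n a.+1 b.+1.
Proof.
apply/setP=> y; rewrite -[y]ord_predK mem_imset; last exact: ordS_inj.
move: (ord_pred y) => x.
by rewrite !inE /= !modn_mod -(addn1 x) -(addn1 a) -(addn1 b) !eqn_modDr.
Qed.

Lemma edge_ord n (x y : 'I_n) : edge n x y = [set x; y].
Proof. by apply/setP=> z; rewrite !inE !modn_small // ?ltn_ord. Qed.

Lemma card_edge n (x y : nat) : x < y < n -> #|edge n x y| = 2.
Proof.
move=> /andP[xy yn]; have xn := ltn_trans xy yn.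
have := edge_ord n (Ordinal xn) (Ordinal yn) => /= ->.
by rewrite cards2 -val_eqE /= ltn_eqF.
Qed.

Lemma lab_edge_shift n (F : 'I_3 -> graph n) a b k :
  sigma_partition F -> a < b < n ->
  lab F (edge n (a + k) (b + k)) = (lab F (edge n a b) + k) %% 3 :> nat.
Proof.
move=> Fp abn.
suff: #|edge n (a + k) (b + k)| = 2 /\
  lab F (edge n (a + k) (b + k)) = (lab F (edge n a b) + k) %% 3 :> nat.
  by case.
elim: k => [|k [IH2 IH]].
  by rewrite !addn0 card_edge // modn_small.
rewrite !addnS -edge_ordS card_imset; last exact: ordS_inj.
by split=> //; rewrite lab_ordS // IH; lia.
Qed.

Lemma edge_wrap n j : edge n j n = edge n 0 j.
Proof. by apply/setP=> z; rewrite !inE modnn mod0n orbC. Qed.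

Lemma lab_level m (F : 'I_3 -> graph (2 * m)) b (x y : nat) :
  3 %| m -> sigma_partition F ->
  (forall j, 1 <= j <= m -> b j %% 3 = defining_sequence F j) ->
  x < y < 2 * m ->
  lab F (edge (2 * m) x y) = level (extend m b) x y %% 3 :> nat.
Proof.
move=> m3 Fp bF /andP[xy ym].
have lab0 j :
    1 <= j < 2 * m -> lab F (edge (2 * m) 0 j) = extend m b j %% 3 :> nat.
  move=> /andP[j0 jm]; rewrite /extend; case: leqP => jm'.
    by rewrite bF ?j0.
  (* The edge {0, j} is the rotation by j of the edge {0, n - j}. *)
  have := lab_edge_shift _ F 0 (2 * m - j) j Fp ltac:(lia).
  rewrite add0n subnK 1?ltnW // edge_wrap => ->.
  have := bF (2 * m - j) ltac:(lia).
  rewrite /defining_sequence /label -/(lab _ _) => <-.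
  lia.
have := lab_edge_shift _ F 0 (y - x) x Fp ltac:(lia).
rewrite add0n subnK 1?ltnW // => ->.
by rewrite lab0 /level; lia.
Qed.

(** * The transitive orientation of the partition *)

(** On the labels 0 and 1, invariance of the arcs under rotation gives the
    equality of digraphs. *)
Lemma sigma_orientation n (F : 'I_3 -> graph n) (T : digraph n) (d d' : 'I_3) :
  sigma_partition F -> d' = d.+1 :> nat ->
  (forall x, (x, x) \notin T) ->
  (forall x y : 'I_n, x != y -> lab F [set x; y] < 2 ->
     ((ordS x, ordS y) \in T) = ((x, y) \in T)) ->
  sigma_digraph (orientation_in T (F d)) = orientation_in T (F d').
Proof.
move=> Fp dd' Tirr TS; apply/setP=> -[u v].
rewrite -[u]ord_predK -[v]ord_predK.
move: (ord_pred u) (ord_pred v) => x y.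
rewrite /sigma_digraph.
have inj : injective (fun a : 'I_n * 'I_n => (ordS a.1, ordS a.2)).
  move=> [p q] [p' q'] /= e; congr (_, _); apply: (@ordS_inj n).
    exact: (congr1 fst e).
  exact: (congr1 snd e).
rewrite (mem_imset _ (x, y) inj) !inE /=.
have [<-|xy] := eqVneq x y; first by rewrite !(negbTE (Tirr _)).
have e2 : #|[set x; y]| = 2 by rewrite cards2 xy.
have es : [set ordS x; ordS y] = @ordS n @: [set x; y].
  by rewrite imsetU1 imset_set1.
have se2 : #|@ordS n @: [set x; y]| = 2 by rewrite card_imset //; exact: ordS_inj.
rewrite es !lab_mem //.
have := lab_ordS n F [set x; y] Fp e2.
have d3 := ltn_ord d'; have := TS x y xy.
rewrite -!val_eqE /= => TS' ls.
have -> : (lab F (@ordS n @: [set x; y]) == d' :> nat) = (lab F [set x; y] == d :> nat).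
  rewrite dd' in d3; rewrite ls dd'; have := ltn_ord (lab F [set x; y]).
  move: (nat_of_ord (lab F [set x; y])) (nat_of_ord d) d3 => l k.
  by move=> k2 l3; apply/eqP/eqP; lia.
by case: eqP => [e|_]; rewrite ?andbF // TS' // e; lia.
Qed.

Theorem theorem2 (n m : nat) (F : 'I_3 -> graph n)
  (n_even : n = 2 * m) (n_div3 : 3 %| n)
  (F_part : sigma_partition F)
  (F_seq : forall j : nat, 1 <= j <= m.-1 ->
     defining_sequence F j.+1 = defining_sequence F j
     \/ defining_sequence F j.+1 = (defining_sequence F j).+1 %[mod 3]) :
  exists T : digraph n, transitive_sigma_orientation F T.
Proof.
subst n.
have m3 : 3 %| m by rewrite Gauss_dvdr in n_div3.
pose a j : nat := defining_sequence F j.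
have bF : forall j, 1 <= j <= m -> lift a j %% 3 = defining_sequence F j.
  apply: lift_mod3 => [j|j jm]; first exact: ltn_ord.
  by rewrite /a; case: (F_seq j jm) => [->|]; [left|right].
pose b := extend m (lift a).
have bS := extend_step m _ (lift_step a); have bsym := extend_sym m (lift a).
rewrite -/b in bS bsym.
pose T : digraph (2 * m) := [set c : 'I_(2 * m) * 'I_(2 * m) | arc m b c.1 c.2].
have Tirr x : (x, x) \notin T by rewrite inE /arc /= ltnn.
have TS (x y : 'I_(2 * m)) : x != y -> lab F [set x; y] < 2 ->
    ((ordS x, ordS y) \in T) = ((x, y) \in T).
  rewrite !inE /=.
  have main (u v : 'I_(2 * m)) : u < v -> lab F [set u; v] < 2 ->
      arc m b (ordS u) (ordS v) = arc m b u v.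
    move=> uv; rewrite -edge_ord (lab_level m _ (lift a)) ?uv ?ltn_ord //.
    exact: arc_ordS.
  case: (ltngtP x y) => [xy _|yx ne|/val_inj->]; [exact: main| |by rewrite eqxx].
  rewrite setUC => /(main _ _ yx) e.
  have sne : ordS y != ordS x :> nat.
    by rewrite (inj_eq val_inj) (inj_eq (@ordS_inj _)) eq_sym.
  by rewrite (arcC _ _ _ _ sne) e (arcC _ _ y x) // eq_sym.
exists T; split; [split=> //| |].
- by move=> x y xy; rewrite !inE /= (arcC _ _ x y) // addbN addbb.
- by move=> x y z; rewrite !inE /=; apply: arc_trans => //; apply: ltn_ord.
- exact: sigma_orientation.
- exact: sigma_orientation.
Qed.
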